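(* Let $S\in \mathbb{C}\langle\!\langle X\rangle\!\rangle x_1\oplus\mathbb{C}1_{X^*}$ with homogeneous decomposition $S=\sum_{n\ge0}[S]_n$, where $[S]_n=\sum_{w\in X^*,\,|w|=n}\langle S\mid w\rangle w$. Let $0<R\le 1$ and suppose that $\sum_{n\ge0}\mathrm{Li}_{[S]_n}$ is unconditionally convergent, for the standard topology, in $\mathcal{H}(D_{<R})$ (so that $\frac{1}{1-z}\sum_{n\ge0}\mathrm{Li}_{[S]_n}(z)$ is unconditionally convergent in the same domain). Write its Taylor expansion at $0$ as $$\frac{1}{1-z}\sum_{n\ge0}\mathrm{Li}_{[S]_n}(z)=\sum_{N\ge0}a_Nz^N .$$ Then, for all $N\ge0$, $$\sum_{n\ge0}\mathrm{H}_{\pi_Y([S]_n)}(N)=a_N .$$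
   Context: Let $X=\{x_0,x_1\}$, $Y=\{y_n\}_{n\ge1}$, with free monoids $X^*,Y^*$ (neutral elements $1_{X^*},1_{Y^*}$). $\mathbb{C}\langle X\rangle$ and $\mathbb{C}\langle\!\langle X\rangle\!\rangle$ denote noncommutative polynomials and series over $X$; $\langle S\mid w\rangle$ is the coefficient of the word $w$ in $S$, and $|w|$ is the length of $w\in X^*$. $\mathbb{C}\langle\!\langle X\rangle\!\rangle x_1\oplus\mathbb{C}1_{X^*}$ is the set of series supported on words ending in $x_1$ together with the empty word. Every word of $X^*x_1$ is uniquely $w=x_0^{s_1-1}x_1\cdots x_0^{s_r-1}x_1$ with $r,s_i\ge1$. For such $w$ and $|z|<1$, $\mathrm{Li}_w(z)=\sum_{n_1>\cdots>n_r>0}\frac{z^{n_1}}{n_1^{s_1}\cdots n_r^{s_r}}$; $\mathrm{Li}_{1_{X^*}}=1$. For $w=y_{s_1}\cdots y_{s_r}\in Y^*$ and $N\in\mathbb{N}$, $\mathrm{H}_w(N)=\sum_{N\ge n_1>\cdots>n_r>0}\frac{1}{n_1^{s_1}\cdots n_r^{s_r}}$; $\mathrm{H}_{1_{Y^*}}(N)=1$. Both are extended linearly to polynomials. $\pi_Y$ is the linear map sending $x_0^{s_1-1}x_1\cdots x_0^{s_r-1}x_1\mapsto y_{s_1}\cdots y_{s_r}$ and $1_{X^*}\mapsto1_{Y^*}$. $D_{<R}=\{z\in\mathbb{C}:|z|<R\}$, and $\mathcal{H}(D_{<R})$ is the space of holomorphic functions on it with the topology of uniform convergence on compact sets (the standard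 topology; for it, unconditional convergence of $\sum f_n$ is equivalent to $\sum_n\sup_K|f_n|<+\infty$ for every compact $K$). *)

(* Defs.v *)
From HB Require Import structures.
From mathcomp Require Import all_boot all_order all_algebra.
From mathcomp Require Import finmap complex.
From mathcomp.multinomials Require Import monalg.
From mathcomp Require Import all_classical all_reals all_analysis.
From mathcomp.analysis.showcase Require summability.

Set Implicit Arguments.
Unset Strict Implicit.
Unset Printing Implicit Defensive.

Import Order.TTheory GRing.Theory Num.Theory.
Import numFieldNormedType.Exports.
Local Open Scope classical_set_scope.
Local Open Scope ring_scope.

(* R[i]^o rather than R[i]: only the former is canonically a normed module
   over R[i], hence carries the topology of the complex plane. *)
Notation cplx R := (R[i]^o).

Definition X : finType := bool.
Definition x0 : X := false.
Definition x1 : X := true.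

Definition Y : countType := {n : nat | (0 < n)%N}.
Definition yS (k : nat) : Y := Sub k.+1 (ltn0Sn k).

Definition ncseries (R : realType) (A : choiceType) := seq A -> cplx R.
Notation ncpoly R A := {malg (cplx R)[seq A]}.

(* X^* x_1 together with the empty word. *)
Definition admissible (w : seq X) : bool := (w == [::]) || (last x0 w == x1).

Definition homog (R : realType) (S : ncseries R X) (n : nat) : ncpoly R X :=
  \sum_(w : n.-tuple X) << S w *g (w : seq X) >>.

(* y_{s_1} ... y_{s_r} |-> x_0^{s_1-1} x_1 ... x_0^{s_r-1} x_1 *)
Definition xword (s : seq Y) : seq X :=
  flatten [seq rcons (nseq (val y).-1 x0) x1 | y <- s].

(* The inverse of xword on admissible words: k counts the letters x_0 read
   since the last x_1. Trailing letters x_0 are dropped. *)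
Fixpoint yword_rec (k : nat) (w : seq X) : seq Y :=
  if w is a :: w' then
    if a == x1 then yS k :: yword_rec 0 w' else yword_rec k.+1 w'
  else [::].
Definition yword (w : seq X) : seq Y := yword_rec 0 w.

Lemma xwordK : cancel xword yword.
Proof.
rewrite /yword; elim=> [//|[[//|m] hm] s IH].
rewrite /xword /= -/(xword s) cat_rcons.
suff H k : yword_rec k (nseq m x0 ++ x1 :: xword s) = yS (k + m) :: s.
  by rewrite H add0n; congr (_ :: _); apply: val_inj.
elim: m k {hm} => [|m IHm] k /=; first by rewrite IH addn0.
by rewrite IHm addSnnS.
Qed.

Lemma ywordK (w : seq X) : admissible w -> xword (yword w) = w.
Proof.
suff H k v : last x1 v == x1 -> (v == [::]) ==> (k == 0)%N ->
    xword (yword_rec k v) = nseq k x0 ++ v.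
  by move=> aw; rewrite /yword H ?eqxx ?implybT//; case: w aw.
elim: v k => [|a v IH] k /= lv; first by move/eqP->.
move=> _; case: (eqVneq a x1) lv => [-> lv|].
  by rewrite /xword /= -/(xword _) IH ?eqxx ?implybT// cat_rcons.
case: a => // _ lv; rewrite IH //; first by rewrite -[k.+1]addn1 nseqD -catA.
  by case: v lv {IH}.
by case: v lv {IH}.
Qed.

Lemma admissible_xword (s : seq Y) : admissible (xword s).
Proof.
case/lastP: s => [//|s y]; apply/orP; right.
by rewrite /xword map_rcons flatten_rcons last_cat last_rcons.
Qed.

(* Words that are not admissible are sent to 0, here and in Li; the series
   considered in the statement have no such word in their support. *)
Definition piY (R : realType) (P : ncpoly R X) : ncpoly R Y :=
  \sum_(w <- msupp P | admissible w) << P@_w *g yword w >>.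

(* n_1 > ... > n_r > 0; the empty sequence qualifies. *)
Definition decr (n : seq nat) : bool := sorted gtn (rcons n 0%N).

(* 1 / (n_1^{s_1} ... n_r^{s_r}) *)
Definition zterm (R : realType) (s : seq Y) (n : seq nat) : cplx R :=
  \prod_(p <- zip n s) (p.1%:R ^+ val p.2)^-1.

(* Unordered sum over all n_1 > ... > n_r > 0. For the empty word, the only
   index is the empty tuple, with term z ^+ 0 = 1. *)
Definition Li_word (R : realType) (w : seq X) (z : cplx R) : cplx R :=
  if admissible w then
    @summability.sum {n : (size (yword w)).-tuple nat | decr n} _ (cplx R)
      (fun n => z ^+ head 0%N (val n) * zterm R (yword w) (val n))
  else 0.

Definition Li (R : realType) (P : ncpoly R X) (z : cplx R) : cplx R :=
  \sum_(w <- msupp P) P@_w * Li_word w z.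

Definition H_word (R : realType) (s : seq Y) (N : nat) : cplx R :=
  \sum_(n : (size s).-tuple 'I_N.+1 | decr (map val n))
     zterm R s (map val n).

Definition H (R : realType) (Q : ncpoly R Y) (N : nat) : cplx R :=
  \sum_(s <- msupp Q) Q@_s * H_word R s N.

Definition disk (R : realType) (r : R) : set (cplx R) :=
  [set z | `|z| < r%:C%C].

Definition holomorphic (R : realType) (D : set (cplx R))
    (f : cplx R -> cplx R) : Prop :=
  forall z, D z -> derivable f z 1.

(* All rearrangements of the series of the f n converge to F in the space of
   holomorphic functions on D, for the topology of compact convergence. *)
Definition uncond_sum (R : realType) (D : set (cplx R))
    (f : nat -> cplx R -> cplx R) (F : cplx R -> cplx R) : Prop :=
  holomorphic D F /\
  forall sigma : nat -> nat, bijective sigma ->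
    {family compactly_in D,
      (fun n z => \sum_(0 <= k < n) f (sigma k) z) @ \oo --> F}.

Definition power_expansion (R : realType) (D : set (cplx R))
    (a : nat -> cplx R) (f : cplx R -> cplx R) : Prop :=
  forall z, D z -> series (fun N => a N * z ^+ N) @ \oo --> f z.

(* Main.v *)
Require Import Defs.
From mathcomp Require Import all_boot all_order all_algebra.
From mathcomp Require Import finmap complex ring lra.
From mathcomp Require Import cyclic separable cyclotomic.
From mathcomp.multinomials Require Import monalg.
From mathcomp Require Import all_classical all_reals all_analysis.
From mathcomp.analysis.showcase Require summability.
Import Order.TTheory GRing.Theory Num.Theory.
Import numFieldNormedType.Exports.
Local Open Scope classical_set_scope.
Local Open Scope ring_scope.

(** The theorem is the passage to the limit, coefficient by coefficient, in one
  sequence of power series.  For a single word w and |z| < 1, grouping the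
  terms of Li_w by the value of the largest index n_1 and dividing by 1 - z
  turns the sums over n_1 = n into the sums over n_1 <= N, so that
  (1 - z)^-1 Li_w(z) is the generating series of N |-> H_w(N)
  ([Li_word_expansion]).  By linearity the coefficients of
  (1 - z)^-1 Li_[S]_n(z) are the numbers H(piY [S]_n, N) ([Li_expansion]).

  The hypothesis gives locally uniform convergence on the disk of the partial
  sums over n, first without and then with the factor (1 - z)^-1, which is
  bounded on compact subsets of the disk because r <= 1
  ([uncond_sum_div1B]).  A locally uniform limit of power series is a power
  series whose coefficients are the limits of the coefficients
  ([power_expansion_limit]); this yields the existence of the expansion and,
  since expansions are unique ([power_expansion_unique]), the value of a_N.

  Both facts on power series rest on the Cauchy estimate
  |c_k| rho^k <= sup over |z| = rho of |f(z)| ([cauchy_estimate]).  It is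
  obtained without integration: for a polynomial of degree less than n, the
  mean over the n-th roots of unity replaces the mean over the circle and is
  exact ([cauchy_estimate_poly]); a power series is then approximated
  uniformly on the circle by its partial sums. *)

Set Implicit Arguments.
Unset Strict Implicit.
Unset Printing Implicit Defensive.

(** * The complex modulus and the topology of the plane *)

(** The norm `|z| lies in R[i], which is only partially ordered; with a modulus
  in R the estimates take place in a totally ordered field. *)
Definition cabs (R : realType) (z : cplx R) : R := Normc.normc z.

Section Modulus.
Context {R : realType}.
Implicit Types (z w : cplx R) (e : R).

Lemma normr_cabs z : `|z| = (cabs z)%:C%C.
Proof. by []. Qed.

Lemma cabs_ge0 z : 0 <= cabs z.
Proof. by case: z => a b; exact: sqrtr_ge0. Qed.

Lemma cabs0 : cabs (0 : cplx R) = 0. Proof. exact: Normc.normc0. Qed.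

Lemma cabs1 : cabs (1 : cplx R) = 1. Proof. exact: Normc.normc1. Qed.

Lemma cabsM z w : cabs (z * w) = cabs z * cabs w.
Proof. exact: Normc.normcM. Qed.

Lemma cabsV z : cabs z^-1 = (cabs z)^-1.
Proof. exact: Normc.normcV. Qed.

Lemma cabsN z : cabs (- z) = cabs z.
Proof. exact: normcN. Qed.

Lemma cabsX z n : cabs (z ^+ n) = cabs z ^+ n.
Proof. by elim: n => [|n IH]; rewrite ?expr0 ?cabs1// !exprS cabsM IH. Qed.

Lemma cabsD z w : cabs (z + w) <= cabs z + cabs w.
Proof. exact: le_normcD. Qed.

Lemma cabsB z w : cabs (z - w) = cabs (w - z).
Proof. by rewrite -cabsN opprB. Qed.

Lemma cabs_dist z u w : cabs (z - w) <= cabs (z - u) + cabs (u - w).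
Proof. by rewrite -[z - w](subrKA u); exact: cabsD. Qed.

Lemma cabs_sum I (s : seq I) (P : pred I) (f : I -> cplx R) :
  cabs (\sum_(i <- s | P i) f i) <= \sum_(i <- s | P i) cabs (f i).
Proof.
elim/big_rec2: _ => [|i x z _ h]; first by rewrite cabs0.
by apply: (le_trans (cabsD _ _)); rewrite lerD2l.
Qed.

Lemma cabs_prod I (s : seq I) (P : pred I) (f : I -> cplx R) :
  cabs (\prod_(i <- s | P i) f i) = \prod_(i <- s | P i) cabs (f i).
Proof. by elim/big_rec2: _ => [|i x z _ <-]; rewrite ?cabs1 ?cabsM. Qed.

Lemma cabsR e : cabs (e%:C%C : cplx R) = `|e|.
Proof. by rewrite /cabs /= expr0n addr0 sqrtr_sqr. Qed.

Lemma cabs_nat n : cabs (n%:R : cplx R) = n%:R.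
Proof. by rewrite -(rmorph_nat (real_complex R)) cabsR ger0_norm. Qed.

Lemma disk_cabs (r : R) z : disk r z <-> cabs z < r.
Proof. by rewrite /disk /= normr_cabs ltcR. Qed.

Lemma cvg_cabs {T} {F : set_system T} {FF : Filter F} (f : T -> cplx R) l :
  f @ F --> l <-> forall e, 0 < e -> \forall x \near F, cabs (l - f x) < e.
Proof.
split=> [/cvgrPdist_lt h e e0|h].
  have /h : 0 < (e%:C%C : cplx R) by rewrite ltcR.
  by apply: filterS => x; rewrite normr_cabs ltcR.
apply/cvgrPdist_lt => e; rewrite ltcE => /andP[/eqP/= ie re].
have {ie} -> : e = (complex.Re e)%:C%C by case: e ie re => a b /= -> .
by apply: filterS (h _ re) => x; rewrite normr_cabs ltcR.
Qed.

Lemma cvgn_cabs (u : nat -> cplx R) l :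
  u @ \oo --> l <->
  forall e, 0 < e -> exists n0, forall n, (n0 <= n)%N -> cabs (u n - l) <= e.
Proof.
split=> [/cvg_cabs h e e0|h].
  by have [n0 _ hn] := h e e0; exists n0 => n /hn/= /ltW; rewrite cabsB.
apply/cvg_cabs => e e0; have [|n0 hn] := h (e / 2); first by rewrite divr_gt0.
exists n0 => // n /= /hn; rewrite cabsB => /le_lt_trans; apply.
by rewrite ltr_pdivrMr// ltr_pMr// ltr1n.
Qed.

Lemma cabs_Re z : `|complex.Re z| <= cabs z.
Proof. by rewrite -lecR; exact: normc_ge_Re. Qed.

Lemma cabs_Im z : `|complex.Im z| <= cabs z.
Proof.
case: z => a b; rewrite /cabs/= -sqrtr_sqr ler_sqrt ?sqr_ge0//.
  by rewrite lerDr sqr_ge0.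
by rewrite addr_ge0 ?sqr_ge0.
Qed.

Lemma cabs_ReIm z : cabs z <= `|complex.Re z| + `|complex.Im z|.
Proof.
case: z => a b; rewrite /cabs/= -[leRHS]ger0_norm ?addr_ge0// -sqrtr_sqr.
rewrite ler_sqrt ?sqr_ge0// sqrrD !real_normK ?num_real//.
by rewrite lerD2r lerDl mulrn_wge0// mulr_ge0.
Qed.

Lemma cabs_eq0P z : (forall e, 0 < e -> cabs z <= e) -> z = 0.
Proof.
move=> h; apply: Normc.eq0_normc; apply/eqP; rewrite eq_le cabs_ge0 andbT.
by apply/ler_addgt0Pl => e /h; rewrite addr0.
Qed.

(** Real and imaginary parts are 1-Lipschitz, so they are Cauchy in R. *)
Lemma complex_complete (u : nat -> cplx R) :
  (forall e, 0 < e -> exists n0, forall n m,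
     (n0 <= n)%N -> (n0 <= m)%N -> cabs (u n - u m) <= e) ->
  exists l : cplx R, u @ \oo --> l.
Proof.
move=> h.
have real_lim (p : cplx R -> R) : (forall z w, p (z - w) = p z - p w) ->
    (forall z, `|p z| <= cabs z) -> exists l : R, p \o u @ \oo --> l.
  move=> pB pc; suff /cvg_ex[l hl] : cvg (p \o u @ \oo) by exists l.
  apply/cauchy_cvgP/cauchyP => e e0.
  have [|n0 hn] := h (e / 2); first by rewrite divr_gt0.
  exists (p (u n0)); exists n0 => // n /= n0n.
  rewrite /ball/= -pB (le_lt_trans (pc _))// (le_lt_trans (hn _ _ _ _))//.
  by rewrite ltr_pdivrMr// ltr_pMr// ltr1n.
have [|a ha] := real_lim (@complex.Re R) _ cabs_Re; first by case=> ? ? [].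
have [|b hb] := real_lim (@complex.Im R) _ cabs_Im; first by case=> ? ? [].
exists (Complex a b); apply/cvg_cabs => e e0.
have e20 : 0 < e / 2 by rewrite divr_gt0.
move/cvgrPdist_lt/(_ _ e20) : ha => ha; move/cvgrPdist_lt/(_ _ e20) : hb => hb.
near=> n; apply: (le_lt_trans (cabs_ReIm _)).
rewrite (splitr e); apply: ltrD; last first.
  have: `|b - (@complex.Im R \o u) n| < e / 2 by near: n.
  by rewrite /=; case: (u n).
have: `|a - (@complex.Re R \o u) n| < e / 2 by near: n.
by rewrite /=; case: (u n).
Unshelve. all: by end_near.
Qed.

Lemma continuous_cabs : continuous (@cabs R).
Proof.
move=> z; apply/(@cvgrPdist_lt _ _ _ _ (nbhs_filter z)) => e e0.
have [/(_ cvg_id)/(_ e e0) near_z _] :=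
  @cvg_cabs _ (nbhs z) (nbhs_filter z) id z.
apply: filterS near_z => w; apply: le_lt_trans.
rewrite ler_norml lerBlDr lerBrDl.
by have := cabsD (w - z) z; have := cabsD (z - w) w; rewrite !subrK cabsB; lra.
Qed.

(** The closed ball is a closed subset of a square, the continuous image of a
  product of segments under (a, b) |-> a + ib. *)
Lemma compact_closed_ball (rho : R) : compact [set z : cplx R | cabs z <= rho].
Proof.
pose box := `[- rho, rho]%classic `*` `[- rho, rho]%classic : set (R * R).
pose mk (p : R * R) : cplx R := Complex p.1 p.2.
have cmk : continuous mk.
  move=> p; apply/(@cvg_cabs _ _ (nbhs_filter p)) => e e0; case: p => a b.
  have e20 : 0 < e / 2 by rewrite divr_gt0.
  exists (ball a (e / 2), ball b (e / 2)).
    by split; apply: nbhsx_ballx.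
  move=> [x y] [/= hx hy].
  change (cabs (Complex (a - x) (b - y) : cplx R) < e).
  apply: (le_lt_trans (cabs_ReIm _)).
  by rewrite (splitr e); apply: ltrD.
have cbox : compact (mk @` box).
  apply: continuous_compact; first by apply: continuous_subspaceT.
  by apply: compact_setX; exact: segment_compact.
have -> : [set z : cplx R | cabs z <= rho] =
    [set z : cplx R | cabs z <= rho] `&` mk @` box.
  apply/seteqP; split=> [[a b]|z []//] /= zr; split=> //.
  exists (a, b) => //; split; rewrite /= in_itv/= -ler_norml.
    exact: le_trans (cabs_Re (Complex a b)) zr.
  exact: le_trans (cabs_Im (Complex a b)) zr.
rewrite setIC; apply: compact_closedI => //.
apply: (@closed_comp _ _ (@cabs R) [set x | x <= rho]); last exact: closed_le.
by move=> z _; exact: continuous_cabs.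
Qed.

(** The modulus attains its maximum on K, so K stays away from the boundary. *)
Lemma compact_sub_disk (r : R) (K : set (cplx R)) : 0 < r ->
  compact K -> K `<=` disk r ->
  exists rho, [/\ 0 <= rho, rho < r & forall z, K z -> cabs z <= rho].
Proof.
move=> r0 cK Kr; have [->|/set0P K0] := eqVneq K set0.
  by exists 0; split.
have [|c cK0 hc] := @compact_EVT_max _ _ (@cabs R) K K0 cK.
  by apply: continuous_subspaceT; exact: continuous_cabs.
exists (cabs c); split; first exact: cabs_ge0.
- by apply/disk_cabs/Kr; rewrite -inE.
- by move=> z Kz; apply: hc; rewrite inE.
Qed.

(** Compact convergence in the epsilon form that the estimates use. *)
Lemma cvg_compactly (D : set (cplx R)) (g : nat -> cplx R -> cplx R) G :
  {family compactly_in D, g @ \oo --> G} <->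
  forall K, compact K -> K `<=` D -> forall e, 0 < e ->
    exists n0, forall n, (n0 <= n)%N ->
      forall z, K z -> cabs (g n z - G z) <= e.
Proof.
split=> [/fam_cvgP h K cK KD e e0|h].
  have ent : entourage [set xy : cplx R * cplx R | cabs (xy.1 - xy.2) < e].
    rewrite -entourage_ballE; exists (e%:C%C : cplx R) => /=.
      by rewrite ltcR.
    by move=> [x y] /=; rewrite -ball_normE /= normr_cabs ltcR.
  have nbG : nbhs (G : {uniform` K -> cplx R})
      [set f : {uniform` K -> cplx R} | forall z, K z -> cabs (G z - f z) < e].
    by apply/uniform_nbhs; exists [set xy | cabs (xy.1 - xy.2) < e]; split.
  have [n0 _ hn] := h K (conj KD cK) _ nbG.
  by exists n0 => n /hn/= hK z /hK/ltW; rewrite cabsB.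
apply/fam_cvgP => K [KD cK] P /uniform_nbhs[E [entE EP]].
move: entE; rewrite -entourage_ballE => -[e /=].
rewrite ltcE => /andP[/eqP/= ie re] eE.
have {ie} ee : e = (complex.Re e)%:C%C by case: e ie {re eE} => a b /= -> .
have [|n0 hn] := h K cK KD (complex.Re e / 2); first by rewrite divr_gt0.
exists n0 => // n /= n0n; apply: EP => z Kz; apply: eE.
rewrite /= -ball_normE /= ee normr_cabs ltcR cabsB.
apply: (le_lt_trans (hn _ n0n _ Kz)).
by rewrite ltr_pdivrMr// ltr_pMr// ltr1n.
Qed.

End Modulus.

(** * Power series on a disk *)

Section PowerSeries.
Context {R : realType}.
Implicit Types (z w : cplx R) (c : nat -> cplx R) (f : cplx R -> cplx R).
Implicit Types (r rho e B : R).

Lemma closed_field_prim_root (K : closedFieldType) n :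
  n%:R != 0 :> K -> exists z : K, n.-primitive_root z.
Proof.
move=> nK; have n0 : (0 < n)%N by case: n nK => //; rewrite eqxx.
have [s] := closed_field_poly_normal ('X^n - 1 : {poly K}).
rewrite (monicP (monicXnsubC _ n0)) scale1r => Ds.
have s1 : all n.-unity_root s.
  by apply/allP => z; rewrite -root_prod_XsubC -Ds.
have sU : uniq s by rewrite -separable_prod_XsubC -Ds separable_Xn_sub_1.
have ns : (n <= size s)%N.
  by rewrite -ltnS -(size_prod_XsubC s id) -Ds size_XnsubC.
by have /hasP[z _ zn] := has_prim_root n0 s1 sU ns; exists z.
Qed.

(** Discrete orthogonality of the characters of Z/n. *)
Lemma sum_prim_root n z (i j : 'I_n) : n.-primitive_root z ->
  \sum_(k < n) (z ^+ i / z ^+ j) ^+ k = (i == j)%:R * n%:R.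
Proof.
move=> zn; have z0 : z != 0.
  by rewrite (prim_root_eq0 zn) -lt0n (prim_order_gt0 zn).
have zj : z ^+ j != 0 by rewrite expf_neq0.
have [->|ij] := eqVneq i j.
  rewrite divff// mul1r (eq_bigr (fun=> 1)) => [|k _]; last by rewrite expr1n.
  by rewrite sumr_const card_ord.
rewrite mul0r; apply/(mulfI (_ : z ^+ i / z ^+ j - 1 != 0)).
  rewrite subr_eq0; apply: contra ij => /eqP/(congr1 ( *%R^~ (z ^+ j))).
  rewrite divfK// mul1r => /eqP; rewrite (eq_prim_root_expr zn).
  by rewrite !modn_small.
rewrite -subrX1 mulr0 expr_div_n -!exprM ![(_ * n)%N]mulnC !exprM.
by rewrite (prim_expr_order zn) !expr1n divr1 subrr.
Qed.

(** By orthogonality, n c_k rho^k is the sum over j < n of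
  p(rho w^j) w^(-jk), for w a primitive n-th root of unity; each term has
  modulus at most B. *)
Lemma cauchy_estimate_poly c n rho B : 0 <= rho ->
  (forall z, cabs z = rho -> cabs (\sum_(k < n) c k * z ^+ k) <= B) ->
  forall k, (k < n)%N -> cabs (c k) * rho ^+ k <= B.
Proof.
move=> rho0 hB k kn; have n0 : (0 < n)%N by case: (n) kn.
have [w wn] : exists w : cplx R, n.-primitive_root w.
  by apply: closed_field_prim_root; rewrite pnatr_eq0 -lt0n.
have w1 : cabs w = 1.
  apply/eqP; rewrite -(@pexpr_eq1 _ _ n) ?cabs_ge0// -cabsX.
  by rewrite (prim_expr_order wn) cabs1.
pose k' := Ordinal kn; pose q : cplx R := (rho%:C)%C.
have key : \sum_(j < n) (\sum_(i < n) c i * (q * w ^+ j) ^+ i) / (w ^+ k) ^+ j =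
    n%:R * (c k * q ^+ k).
  transitivity (\sum_(i < n) c i * q ^+ i *
                  \sum_(j < n) (w ^+ i / w ^+ k') ^+ j).
    under eq_bigr do rewrite mulr_suml; rewrite exchange_big/=.
    apply: eq_bigr => i _; rewrite mulr_sumr; apply: eq_bigr => j _.
    by rewrite exprMn expr_div_n -!exprM [(j * i)%N]mulnC !mulrA.
  under eq_bigr do rewrite (sum_prim_root _ _ wn).
  rewrite (bigD1 k')//= eqxx mul1r big1 ?addr0; first by rewrite mulrC.
  by move=> i /negPf ->; rewrite mul0r mulr0.
have nR : 0 < n%:R :> R by rewrite ltr0n.
rewrite -(ler_pM2l nR) -[rho]ger0_norm// -cabsR -cabsX -cabsM -cabs_nat -cabsM.
rewrite -key cabs_nat; apply: (le_trans (cabs_sum _ _ _)).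
rewrite mulr_natl -[X in _ *+ X]card_ord -sumr_const; apply: ler_sum => j _.
rewrite cabsM cabsV !cabsX w1 !expr1n invr1 mulr1; apply: hB.
by rewrite cabsM cabsX w1 expr1n mulr1 cabsR ger0_norm.
Qed.

Lemma geometric_tail_le (q : R) m n : 0 <= q < 1 ->
  \sum_(m <= k < n) q ^+ k <= q ^+ m / (1 - q).
Proof.
case/andP=> q0 q1; have q1' : 0 < 1 - q by rewrite subr_gt0.
have [mn|nm] := leqP m n; last first.
  by rewrite big_geq ?(ltnW nm)// divr_ge0 ?exprn_ge0// ltW.
rewrite ler_pdivlMr// mulrC -{1}[m]add0n big_addn mulr_sumr.
rewrite (eq_bigr (fun k => q ^+ m * ((1 - q) * q ^+ k))); last first.
  by move=> k _; rewrite exprD; ring.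
rewrite -mulr_sumr -mulr_sumr big_mkord -opprB mulNr -subrX1 opprB.
by rewrite ler_piMr ?exprn_ge0// gerBl exprn_ge0.
Qed.

Lemma cvg_bounded c : cvgn c -> exists B, forall n, cabs (c n) <= B.
Proof.
move=> /cvg_ex[l /cvgn_cabs/(_ 1 ltr01)[n0 hn]].
exists (1 + cabs l + \sum_(k < n0) cabs (c k)) => n.
have [/hn h|nn0] := leqP n0 n.
  apply: ler_wpDr; first by apply: sumr_ge0 => k _; exact: cabs_ge0.
  have := cabsD (c n - l) l; rewrite subrK => /le_trans; apply.
  by rewrite lerD2r.
apply: ler_wpDl; first by rewrite addr_ge0 ?cabs_ge0.
by rewrite (bigD1 (Ordinal nn0))//= lerDl sumr_ge0// => k _; exact: cabs_ge0.
Qed.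

Lemma series_cvg_bounded c :
  cvgn (series c) -> exists B, forall n, cabs (c n) <= B.
Proof. by move=> /cvg_series_cvg_0/cvgP; exact: cvg_bounded. Qed.

(** Comparison with a geometric series of ratio rho / rho'; the bound does not
  depend on z, so partial sums converge uniformly on the circle. *)
Lemma power_series_tail c rho rho' B z l : 0 <= rho -> rho < rho' ->
  (forall n, cabs (c n) * rho' ^+ n <= B) -> cabs z <= rho ->
  series (fun n => c n * z ^+ n) @ \oo --> l ->
  forall n, cabs (l - \sum_(k < n) c k * z ^+ k) <=
            B * ((rho / rho') ^+ n / (1 - rho / rho')).
Proof.
move=> rho0 rr cB zrho hl n; have rho'0 : 0 < rho' := le_lt_trans rho0 rr.
set q := rho / rho'.
have q01 : 0 <= q < 1.
  by rewrite /q divr_ge0 ?(ltW rho'0)//= ltr_pdivrMr// mul1r.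
have B0 : 0 <= B by apply: le_trans (cB 0%N); rewrite mulr_ge0 ?cabs_ge0.
apply/ler_addgt0Pl => e e0.
move/cvgn_cabs/(_ e e0) : hl => [n0 hn].
have := hn (maxn n n0) (leq_maxr _ _); rewrite cabsB => h.
set p := \sum_(k < n) _; set s := series _ _ in h.
apply: (le_trans (cabs_dist _ s _)); apply: lerD => //.
have -> : s - p = \sum_(n <= k < maxn n n0) c k * z ^+ k.
  rewrite /s /p seriesEnat/= -(big_mkord xpredT (fun k => c k * z ^+ k)).
  rewrite [X in X - _](@big_cat_nat _ _ _ n)//= ?leq_maxl//.
  by rewrite [X in X - _]addrC addrK.
apply: (le_trans (cabs_sum _ _ _)).
have hq := geometric_tail_le n (maxn n n0) q01.
apply: le_trans (ler_wpM2l B0 hq); rewrite mulr_sumr; apply: ler_sum => k _.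
have rk : 0 < rho' ^+ k by rewrite exprn_gt0.
rewrite cabsM cabsX expr_div_n mulrA ler_pdivlMr// mulrAC.
apply: ler_pM; rewrite ?mulr_ge0 ?cabs_ge0 ?exprn_ge0 ?cabs_ge0 ?(ltW rho'0)//.
by rewrite lerXn2r ?nnegrE ?cabs_ge0.
Qed.

Lemma geometric_small B (q e : R) : 0 <= q < 1 -> 0 < e ->
  exists n0, forall n, (n0 <= n)%N -> B * q ^+ n <= e.
Proof.
case/andP=> q0 q1 e0.
have /cvgrPdist_lt/(_ _ e0)[n0 _ hn] : (fun n => B * q ^+ n) @ \oo --> (0 : R).
  rewrite -[X in _ --> X](mulr0 B); apply: cvgMl_tmp; apply: cvg_expr.
  by rewrite ger0_norm.
exists n0 => n /hn/=; rewrite sub0r normrN => /ltW; apply: le_trans.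
exact: ler_norm.
Qed.

(** The polynomial estimate applies to the partial sums of the series, at the
  cost of their uniform distance to f, which is as small as desired.  The
  intermediate radius rho' provides the geometric control of the tail. *)
Lemma cauchy_estimate r c f rho B : 0 <= rho -> rho < r ->
  power_expansion (disk r) c f ->
  (forall z, cabs z = rho -> cabs (f z) <= B) ->
  forall k, cabs (c k) * rho ^+ k <= B.
Proof.
move=> rho0 rr cf fB k; pose rho' := (rho + r) / 2.
have [r1 r2] : rho < rho' /\ rho' < r by rewrite /rho'; lra.
have rho'0 : 0 < rho' by apply: le_lt_trans r1.
have [|C hC] := @series_cvg_bounded (fun n => c n * (rho'%:C)%C ^+ n).
  by apply/cvgP/cf/disk_cabs; rewrite cabsR gtr0_norm.
have {}hC n : cabs (c n) * rho' ^+ n <= C.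
  by have := hC n; rewrite cabsM cabsX cabsR gtr0_norm.
have q01 : 0 <= rho / rho' < 1.
  by rewrite divr_ge0 ?(ltW rho'0)//= ltr_pdivrMr// mul1r.
apply/ler_addgt0Pl => e e0.
have [n0 hn] := @geometric_small (C / (1 - rho / rho')) _ e q01 e0.
pose n := maxn n0 k.+1.
apply: (@cauchy_estimate_poly c n) => //; last by rewrite leq_maxr.
move=> z zrho; have zr : disk r z by apply/disk_cabs; rewrite zrho.
have := @power_series_tail c rho rho' C z (f z) rho0 r1 hC _ (cf z zr) n.
rewrite zrho => /(_ (lexx _)) ht.
set p := \sum_(_ < n) _ in ht *.
have := cabs_dist p (f z) 0; rewrite !subr0 => /le_trans; apply.
rewrite cabsB; apply: lerD; last exact: fB.
by apply: (le_trans ht); rewrite mulrA mulrAC; apply: hn; rewrite leq_maxl.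
Qed.

Lemma power_expansionB r c c' f f' : power_expansion (disk r) c f ->
  power_expansion (disk r) c' f' ->
  power_expansion (disk r) (fun n => c n - c' n) (fun z => f z - f' z).
Proof.
move=> cf cf' z zr.
have -> : series (fun n => (c n - c' n) * z ^+ n) =
    series (fun n => c n * z ^+ n) - series (fun n => c' n * z ^+ n).
  apply/funext => n; rewrite fctE !seriesEnat/= -sumrB.
  by apply: eq_bigr => k _; rewrite mulrBl.
exact: cvgB (cf z zr) (cf' z zr).
Qed.

Lemma power_expansion_unique r c c' f : 0 < r ->
  power_expansion (disk r) c f -> power_expansion (disk r) c' f -> c = c'.
Proof.
move=> r0 cf cf'; apply/funext => n; apply/eqP; rewrite -subr_eq0; apply/eqP.
have r2 : 0 < r / 2 by rewrite divr_gt0.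
apply: cabs_eq0P => e e0; apply: le_trans (ltW e0).
have := @cauchy_estimate r _ _ (r / 2) 0 (ltW r2) _ (power_expansionB cf cf').
move=> /(_ _ _ n); rewrite pmulr_lle0 ?exprn_gt0//; apply; first by lra.
by move=> z _; rewrite subrr cabs0.
Qed.

(** The Weierstrass theorem for power series.  The Cauchy estimate applied to
  g_n - g_m shows that the coefficients are Cauchy sequences, uniformly in k
  after multiplication by rho^k; this uniformity is what allows the passage to
  the limit inside the series at any |z| < rho. *)
Lemma power_expansion_limit r (c : nat -> nat -> cplx R)
    (g : nat -> cplx R -> cplx R) G : 0 < r ->
  (forall n, power_expansion (disk r) (c n) (g n)) ->
  (forall rho, 0 < rho -> rho < r -> forall e, 0 < e -> exists n0, forall n,
     (n0 <= n)%N -> forall z, cabs z <= rho -> cabs (g n z - G z) <= e) ->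
  exists2 a, power_expansion (disk r) a G & forall k, c ^~ k @ \oo --> a k.
Proof.
move=> r0 cg gG.
have estimate rho : 0 < rho -> rho < r -> forall e, 0 < e -> exists n0,
    forall n m k, (n0 <= n)%N -> (n0 <= m)%N ->
    cabs (c n k - c m k) * rho ^+ k <= e.
  move=> rho0 rr e e0; have [|n0 hn] := gG rho rho0 rr (e / 2).
    by rewrite divr_gt0.
  exists n0 => n m k n0n n0m.
  apply: (cauchy_estimate (ltW rho0) rr (power_expansionB (cg n) (cg m))).
  move=> z zrho; apply: (le_trans (cabs_dist _ (G z) _)).
  by rewrite (splitr e) [cabs (G z - _)]cabsB lerD// hn// zrho.
have [a ha] : exists a : nat -> cplx R, forall k, c ^~ k @ \oo --> a k.
  have [|a ha] := @choice _ _ (fun k (l : cplx R) => c ^~ k @ \oo --> l).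
    move=> k.
    apply: complex_complete => e e0.
    have r2 : 0 < r / 2 by rewrite divr_gt0.
    have [||n0 hn] := estimate (r / 2) r2 _ (e * (r / 2) ^+ k); first by lra.
      by rewrite mulr_gt0// exprn_gt0.
    by exists n0 => n m n0n n0m; rewrite -(ler_pM2r (exprn_gt0 k r2)) hn.
  by exists a.
exists a => // z /disk_cabs zr.
have z0 := cabs_ge0 z.
pose rho := (cabs z + r) / 2.
have [zrho rr] : cabs z < rho /\ rho < r by rewrite /rho; lra.
have rho0 : 0 < rho by apply: le_lt_trans zrho.
pose q := cabs z / rho.
have q01 : 0 <= q < 1.
  by rewrite divr_ge0 ?cabs_ge0 ?ltW//= ltr_pdivrMr// mul1r.
have q1 : 0 < 1 - q by rewrite subr_gt0; case/andP: q01.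
apply/cvgn_cabs => e e0; have e30 : 0 < e / 3 by rewrite divr_gt0.
have [|n0 hn0] := estimate rho rho0 rr (e / 3 * (1 - q)).
  by rewrite mulr_gt0.
have [n1 hn1] := gG rho rho0 rr (e / 3) e30.
pose n := maxn n0 n1.
have acn k : cabs (a k - c n k) * rho ^+ k <= e / 3 * (1 - q).
  rewrite -ler_pdivlMr ?exprn_gt0//; apply/ler_addgt0Pl => d d0.
  have [n2 hn2] := (cvgn_cabs _ _).1 (ha k) d d0.
  apply: (le_trans (cabs_dist _ (c (maxn n0 n2) k) _)); apply: lerD.
    by rewrite cabsB hn2// leq_maxr.
  by rewrite ler_pdivlMr ?exprn_gt0// hn0// leq_maxl.
have [N0 hN0] := (cvgn_cabs _ _).1 (cg n z ((disk_cabs _ _).2 zr)) (e / 3) e30.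
exists N0 => N N0N.
apply: (le_trans (cabs_dist _ (series (fun k => c n k * z ^+ k) N) _)).
(* Three errors: limit coefficients against those of g_n, the tail of the
   series of g_n at z, and g_n against G. *)
have -> : e = e / 3 + (e / 3 + e / 3) by lra.
apply: lerD; last first.
  apply: (le_trans (cabs_dist _ (g n z) _)); apply: lerD; first exact: hN0.
  by apply: hn1; [rewrite leq_maxr | exact: ltW].
rewrite !seriesEnat/= -sumrB; apply: (le_trans (cabs_sum _ _ _)).
apply: (@le_trans _ _ (\sum_(0 <= k < N) (e / 3 * (1 - q)) * q ^+ k)).
  apply: ler_sum => k _; rewrite -mulrBl cabsM cabsX /q expr_div_n mulrA.
  rewrite ler_pdivlMr ?exprn_gt0// mulrAC.
  by apply: ler_wpM2r; rewrite ?exprn_ge0.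
rewrite -mulr_sumr -mulrA ler_piMr// ?(ltW e30)// mulrC -ler_pdivlMr//.
by apply: le_trans (geometric_tail_le 0 N q01) _; rewrite expr0.
Qed.

End PowerSeries.

(** * Generating series of graded sums *)

Section GradedSums.
Context {R : realType}.
Implicit Types (z : cplx R) (e x y : R).

(** Induction on k: Bernoulli's inequality absorbs one factor n + 1 when the
  ratio x is moved halfway towards 1. *)
Lemma poly_geometric_bound k x : 0 <= x < 1 ->
  exists B y, 0 <= y < 1 /\ forall n, (n.+1 ^ k)%:R * x ^+ n <= B * y ^+ n.
Proof.
elim: k x => [|k IH] x /andP[x0 x1].
  by exists 1, x; split=> [|n]; rewrite ?x0.
pose d : R := (1 - x) / 2; have [d0 d1 xd] : [/\ 0 < d, d <= 1 & x + d < 1].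
  by rewrite /d; split; lra.
have [|B [y [y01 hB]]] := IH (x + d).
  by rewrite xd andbT addr_ge0// ltW.
have bernoulli n : x ^+ n * (1 + n%:R * d) <= (x + d) ^+ n.
  elim: n => [|n IHn]; first by rewrite !expr0 mul0r addr0 mulr1.
  rewrite !exprSr.
  apply: (@le_trans _ _ (x ^+ n * (1 + n%:R * d) * (x + d))).
    have xn : 0 <= x ^+ n by rewrite exprn_ge0.
    have nR : 0 <= n%:R :> R by [].
    rewrite -!mulrA; apply: ler_wpM2l => //; rewrite -natr1.
    have := mulr_ge0 (mulr_ge0 nR (ltW d0)) (ltW d0).
    have x1' : 0 <= 1 - x by rewrite subr_ge0 ltW.
    by have := mulr_ge0 (ltW d0) x1'; nra.
  by apply: ler_wpM2r => //; rewrite addr_ge0// ltW.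
exists (d^-1 * B), y; split=> // n.
rewrite expnS natrM -mulrA mulrCA -mulrA.
apply: (@le_trans _ _ (d^-1 * ((n.+1 ^ k)%:R * (x + d) ^+ n))); last first.
  by rewrite ler_wpM2l// invr_ge0 ltW.
rewrite [leRHS]mulrCA ler_wpM2l// ler_pdivlMl//.
apply: le_trans (bernoulli n); rewrite mulrA [leLHS]mulrC.
apply: ler_wpM2l; first exact: exprn_ge0.
rewrite mulrC.
by rewrite -natr1 mulrDl mul1r addrC lerD2r.
Qed.

Lemma big_fset_split (V : nmodType) (I : choiceType) (A B : {fset I})
    (F : I -> V) : (A `<=` B)%fset ->
  \sum_(i <- B) F i = \sum_(i <- A) F i + \sum_(i <- (B `\` A)%fset) F i.
Proof.
move=> AB; rewrite (@big_fsetID _ _ _ _ (mem A)) /=; congr (_ + _).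
  apply: eq_fbigl => i; rewrite !inE/= andbC.
  by case: (boolP (i \in A)) => // /(fsubsetP AB) ->.
by apply: eq_fbigl => i; rewrite !inE/= andbC.
Qed.

(** Abel summation.  The grading hd has the finite sublevel sets A N, and the
  jump of the sum from A N to A (N + 1) comes from the elements of grade
  N + 1 alone. *)
Lemma abel_graded_sum (K : comPzRingType) (I : choiceType) (hd : I -> nat)
    (A : nat -> {fset I}) (u : I -> K) (x : K) :
  (forall N i, (i \in A N) = (hd i <= N)%N) ->
  forall N, \sum_(i <- A N) x ^+ hd i * u i =
    (1 - x) * (\sum_(n < N) (\sum_(i <- A n) u i) * x ^+ n) +
    (\sum_(i <- A N) u i) * x ^+ N.
Proof.
move=> hA; elim=> [|N IH].
  rewrite big_ord0 mulr0 add0r expr0 mulr1; apply: eq_big_seq => i.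
  by rewrite hA leqn0 => /eqP ->; rewrite expr0 mul1r.
have sub : (A N `<=` A N.+1)%fset.
  by apply/fsubsetP => i; rewrite !hA => /leqW.
rewrite (big_fset_split _ sub) IH big_ord_recr /=.
rewrite [\sum_(i <- A N.+1) u i](big_fset_split _ sub).
have -> : \sum_(i <- (A N.+1 `\` A N)%fset) x ^+ hd i * u i =
    x ^+ N.+1 * \sum_(i <- (A N.+1 `\` A N)%fset) u i.
  rewrite mulr_sumr; apply: eq_big_seq => i.
  rewrite in_fsetD !hA -ltnNge andbC => /anti_leq hi.
  by congr (x ^+ _ * u i).
rewrite exprS; ring.
Qed.

(** The engine of the proof: dividing by 1 - z replaces the sum of t over one
  grade by its sum over all smaller grades.  Polynomial growth of the latter
  makes the unordered family absolutely summable for |z| < 1, so that its sum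
  may be computed along the exhaustion A, where Abel summation applies. *)
Lemma cvg_graded_sum (I : choiceType) (hd : I -> nat) (A : nat -> {fset I})
    (t : I -> cplx R) k z :
  (forall N i, (i \in A N) = (hd i <= N)%N) ->
  (forall N, \sum_(i <- A N) cabs (t i) <= (N.+1 ^ k)%:R) ->
  cabs z < 1 ->
  series (fun N => (\sum_(i <- A N) t i) * z ^+ N) @ \oo -->
    (1 - z)^-1 * @summability.sum I _ (cplx R) (fun i => z ^+ hd i * t i).
Proof.
move=> hA ht z1; set x := cabs z; have x0 : 0 <= x by exact: cabs_ge0.
have x01 : 0 <= x < 1 by rewrite x0.
have [B [y [y01 hB]]] := poly_geometric_bound k x01.
have [y0 y1] := andP y01.
have B0 : 0 <= B.
  by have := hB 0%N; rewrite exp1n !mulr1; exact: le_trans.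
have tx N : (\sum_(i <- A N) cabs (t i)) * x ^+ N <= B * y ^+ N.
  by apply: le_trans (hB N); rewrite ler_wpM2r ?exprn_ge0.
pose F i := z ^+ hd i * t i; pose G i := x ^+ hd i * cabs (t i).
have G0 i : 0 <= G i by rewrite mulr_ge0 ?exprn_ge0 ?cabs_ge0.
have FG i : cabs (F i) = G i by rewrite cabsM cabsX.
have subA N M : (N <= M)%N -> (A N `<=` A M)%fset.
  by move=> NM; apply/fsubsetP => i; rewrite !hA => /leq_trans; apply.
have Gbound N : \sum_(i <- A N) G i <= B / (1 - y) + B.
  rewrite (abel_graded_sum _ _ hA); apply: lerD; last first.
    by apply: le_trans (tx N) _; rewrite ler_piMr// exprn_ile1// ltW.
  apply: (@le_trans _ _ (\sum_(n < N) (\sum_(i <- A n) cabs (t i)) * x ^+ n)).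
    rewrite ler_piMl ?gerBl// sumr_ge0// => n _.
    by rewrite mulr_ge0 ?exprn_ge0// sumr_ge0// => i _; exact: cabs_ge0.
  apply: (@le_trans _ _ (\sum_(n < N) B * y ^+ n)); first exact: ler_sum.
  rewrite -mulr_sumr ler_wpM2l// -(big_mkord xpredT (fun n => y ^+ n)).
  by apply: le_trans (geometric_tail_le 0 N y01) _; rewrite expr0 mul1r.
have Gcvg : cvgn (fun N => \sum_(i <- A N) G i).
  apply: nondecreasing_is_cvgn => [N M NM|].
    by rewrite (big_fset_split _ (subA _ _ NM)) lerDl sumr_ge0.
  by exists (B / (1 - y) + B) => _ [N _ <-].
have Ftail e : 0 < e -> exists n0, forall N (J : {fset I}), (n0 <= N)%N ->
    (A N `<=` J)%fset -> cabs (\sum_(i <- J) F i - \sum_(i <- A N) F i) <= e.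
  move=> e0; have [l hl] := (cvg_ex _).1 Gcvg.
  have e20 : 0 < e / 2 by rewrite divr_gt0.
  move/cvgrPdist_lt/(_ _ e20) : hl => [n0 _ hn].
  exists n0 => N J n0N NJ; rewrite (big_fset_split _ NJ) addrC addKr.
  (* Any common bound of N and of the grades of the elements of J. *)
  pose M := (N + \sum_(i <- J) hd i)%N.
  have JM : (J `<=` A M)%fset.
    apply/fsubsetP => i iJ; rewrite hA (leq_trans _ (leq_addl _ _))//.
    by rewrite (big_fsetD1 i)//= leq_addr.
  apply: (@le_trans _ _ (\sum_(i <- (A M `\` A N)%fset) G i)).
    apply: (le_trans (cabs_sum _ _ _)).
    under eq_bigr do rewrite FG.
    by rewrite [leRHS](big_fset_split _ (fsetSD (A N) JM)) lerDl sumr_ge0.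
  have NM : (N <= M)%N by rewrite leq_addr.
  have -> : \sum_(i <- (A M `\` A N)%fset) G i =
      (l - \sum_(i <- A N) G i) - (l - \sum_(i <- A M) G i).
    by rewrite (big_fset_split _ (subA _ _ NM)); ring.
  have h1 := hn N n0N; have h2 := hn M (leq_trans n0N NM).
  move: h1 h2 => /= h1 h2; rewrite [leRHS]splitr.
  apply: le_trans (lerD (ltW h1) (ltW h2)).
  exact: le_trans (ler_norm _) (ler_normB _ _).
have [l hl] : exists l : cplx R, (fun N => \sum_(i <- A N) F i) @ \oo --> l.
  apply: complex_complete => e e0.
  have [|n0 hn] := Ftail (e / 2); first by rewrite divr_gt0.
  exists n0 => n m n0n n0m.
  apply: (le_trans (cabs_dist _ (\sum_(i <- A n0) F i) _)).
  rewrite [leRHS]splitr [X in _ + X]cabsB.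
  by apply: lerD; apply: hn => //; exact: subA.
have totallyF : ProperFilter (@summability.totally I).
  exact: summability.totally_filter.
have -> : @summability.sum I _ (cplx R) F = l.
  apply: cvg_lim; first exact: norm_hausdorff.
  apply/cvg_cabs => e e0.
  have e30 : 0 < e / 3 by rewrite divr_gt0.
  have [n0 hn0] := Ftail _ e30; have [n1 hn1] := (cvgn_cabs _ _).1 hl _ e30.
  exists (A (maxn n0 n1)) => //= J AJ.
  rewrite /summability.partial_sum -(big_seq_fsetE _ J xpredT F)/= cabsB.
  apply: (le_lt_trans (cabs_dist _ (\sum_(i <- A (maxn n0 n1)) F i) _)).
  apply: (@le_lt_trans _ _ (e / 3 + e / 3)); last by lra.
  apply: lerD; last by apply: hn1; exact: leq_maxr.
  by apply: hn0 => //; exact: leq_maxl.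
have z1' : 1 - z != 0.
  by rewrite subr_eq0; apply: contraTneq z1 => <-; rewrite cabs1 ltxx.
have -> : series (fun N => (\sum_(i <- A N) t i) * z ^+ N) =
    (fun N => (1 - z)^-1 *
       (\sum_(i <- A N) F i - (\sum_(i <- A N) t i) * z ^+ N)).
  apply/funext => N; rewrite seriesEnat/= big_mkord (abel_graded_sum _ _ hA).
  by rewrite addrK mulKf.
have vanish : (fun N => (\sum_(i <- A N) t i) * z ^+ N) @ \oo --> (0 : cplx R).
  apply/cvgn_cabs => e e0; have [n0 hn] := geometric_small B y01 e0.
  exists n0 => n /hn; apply: le_trans; rewrite subr0 cabsM cabsX.
  by apply: le_trans (tx n); rewrite ler_wpM2r ?exprn_ge0//; exact: cabs_sum.
apply: cvgMl_tmp; rewrite -[X in _ --> X]subr0.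
exact: cvgB hl vanish.
Qed.

End GradedSums.

(** * Polylogarithms and harmonic sums *)

Section HarmonicSums.
Context {R : realType}.
Implicit Types (s : seq Y) (w : seq X) (z : cplx R).

Lemma decr_le_head (n : seq nat) : decr n -> all (leq^~ (head 0%N n)) n.
Proof.
have gtn_trans : transitive gtn.
  by move=> b a c /= ba cb; exact: ltn_trans cb ba.
case: n => [//|m n]; rewrite /decr /= => /(order_path_min gtn_trans).
by rewrite all_rcons leqnn => /andP[_]; apply: sub_all => i /ltnW.
Qed.

(** For decreasing sequences, a bound on the head bounds all the entries: these
  are the sublevel sets of the head, in the form of finite sets. *)
Definition decr_upto k N : {fset {n : k.-tuple nat | decr n}} :=
  [fset i in pmap insub [seq map_tuple val t | t : k.-tuple 'I_N.+1]]%fset.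

Lemma mem_decr_upto k N (i : {n : k.-tuple nat | decr n}) :
  (i \in decr_upto k N) = (head 0%N (val (val i)) <= N)%N.
Proof.
rewrite in_fset /= mem_pmap_sub; case: i => n /= dn.
apply/mapP/idP => [[t _ ->]|hN].
  by case: t => -[|a t] ? //=; rewrite -ltnS ltn_ord.
have nN (m : nat) : m \in val n -> (m <= N)%N.
  by move=> mn; apply: leq_trans hN; apply: (allP (decr_le_head dn)).
exists (map_tuple inord n); first by rewrite mem_enum.
apply: val_inj; rewrite /= -map_comp map_id_in// => m /nN mN /=.
by rewrite inordK.
Qed.

Lemma big_decr_upto (V : nmodType) k N (F : k.-tuple nat -> V) :
  \sum_(i <- decr_upto k N) F (val i) =
  \sum_(t : k.-tuple 'I_N.+1 | decr (map val t)) F (map_tuple val t).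
Proof.
have U : uniq [seq map_tuple val t | t : k.-tuple 'I_N.+1].
  rewrite map_inj_uniq ?enum_uniq// => t u /(congr1 val)/= tu.
  by apply/val_inj/(inj_map val_inj).
rewrite (perm_big (pmap insub [seq map_tuple val t | t : k.-tuple 'I_N.+1]))/=.
  rewrite big_pmap big_map big_enum [RHS]big_mkcond /=; apply: eq_bigr => t _.
  by case: insubP => [u /= -> <-|/negPf /= ->].
apply: uniq_perm; rewrite ?fset_uniq ?pmap_sub_uniq// => i.
by rewrite in_fset.
Qed.

(** Holds also when some entry of n vanishes, since then 0^-1 = 0. *)
Lemma cabs_zterm s n : cabs (zterm R s n) <= 1.
Proof.
rewrite cabs_prod; apply: prodr_ile1 => -[m y] _ /=; rewrite cabs_ge0/=.
rewrite cabsV cabsX cabs_nat; case: m => [|m].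
  by rewrite expr0n; case: eqP; rewrite ?invr1 ?invr0.
by rewrite invf_le1 ?exprn_gt0// exprn_ege1// ler1n.
Qed.

Lemma H_word_decr s N :
  H_word R s N = \sum_(i <- decr_upto (size s) N) zterm R s (val i).
Proof. by rewrite (big_decr_upto N (fun n : _.-tuple nat => zterm R s n)). Qed.

(** [cvg_graded_sum] for the grading by the largest index n_1.  For s the word
  yword w, at most (N + 1)^(size s) tuples have all entries up to N, which
  gives the growth condition. *)
Lemma Li_word_expansion w z : admissible w -> cabs z < 1 ->
  series (fun N => H_word R (yword w) N * z ^+ N) @ \oo -->
    (1 - z)^-1 * Li_word w z.
Proof.
move=> aw z1; rewrite /Li_word aw; set s := yword w.
have -> : (fun N => H_word R s N * z ^+ N) =
   fun N => (\sum_(i <- decr_upto (size s) N) zterm R s (val i)) * z ^+ N.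
  by apply/funext => N; rewrite H_word_decr.
apply: (cvg_graded_sum (k := size s)
  (hd := fun i : {n : (size s).-tuple nat | decr n} => head 0%N (val i))
  (t := fun i : {n : (size s).-tuple nat | decr n} => zterm R s (val i))) => //.
  by move=> N i; rewrite mem_decr_upto.
move=> N.
rewrite (big_decr_upto N (fun n : _.-tuple nat => cabs (zterm R s n))).
rewrite -[in leRHS](card_ord N.+1) -card_tuple -sumr_const.
rewrite [leRHS](bigID (fun t : _.-tuple 'I_N.+1 => decr (map val t)))/=.
by rewrite ler_wpDr ?sumr_ge0//; apply: ler_sum => t _; exact: cabs_zterm.
Qed.

Lemma H_piY (P : ncpoly R X) N :
  H (piY P) N = \sum_(w <- msupp P | admissible w) P@_w * H_word R (yword w) N.
Proof.
have -> : H (piY P) N = mmap idfun (fun s => H_word R s N) (piY P).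
  by rewrite mmapE.
rewrite /piY raddf_sum; apply: eq_bigr => w _; exact: mmapU.
Qed.

Lemma Li_expansion (P : ncpoly R X) z : cabs z < 1 ->
  series (fun N => H (piY P) N * z ^+ N) @ \oo --> (1 - z)^-1 * Li P z.
Proof.
move=> z1.
have -> : (1 - z)^-1 * Li P z =
    \sum_(w <- msupp P | admissible w) P@_w * ((1 - z)^-1 * Li_word w z).
  rewrite /Li mulr_sumr [RHS]big_mkcond; apply: eq_bigr => w _.
  by rewrite mulrCA /Li_word; case: ifP; rewrite ?mulr0.
have -> : series (fun N => H (piY P) N * z ^+ N) = fun n =>
    \sum_(w <- msupp P | admissible w)
      P@_w * series (fun N => H_word R (yword w) N * z ^+ N) n.
  apply/funext => n; rewrite seriesEnat/=.
  under eq_bigr do rewrite H_piY mulr_suml.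
  rewrite exchange_big/=; apply: eq_bigr => w _.
  by rewrite seriesEnat/= mulr_sumr; apply: eq_bigr => k _; rewrite mulrA.
apply: (cvg_big (op := +%R)) => [x|w aw]; first exact: add_continuous.
 apply: cvgMl_tmp; exact: Li_word_expansion.
Qed.

End HarmonicSums.

(** * Sums of series of functions on the disk *)

Lemma power_expansion_sum (R : realType) (D : set (cplx R)) (I : Type)
    (s : seq I) (c : I -> nat -> cplx R) (f : I -> cplx R -> cplx R) :
  (forall i, power_expansion D (c i) (f i)) ->
  power_expansion D (fun N => \sum_(i <- s) c i N)
    (fun z => \sum_(i <- s) f i z).
Proof.
move=> cf z zD.
have -> : series (fun N => (\sum_(i <- s) c i N) * z ^+ N) =
    fun n => \sum_(i <- s) series (fun N => c i N * z ^+ N) n.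
  apply/funext => n; rewrite seriesEnat/=.
  under eq_bigr do rewrite mulr_suml.
  by rewrite exchange_big; apply: eq_bigr => i _; rewrite seriesEnat.
apply: (cvg_big (op := +%R)) => [x|i _]; first exact: add_continuous.
exact: cf.
Qed.

(** A compact subset of the disk lies in some |z| <= rho with rho < r <= 1,
  where |1 - z| >= 1 - rho. *)
Lemma uncond_sum_div1B (R : realType) (r : R) (f : nat -> cplx R -> cplx R)
    (F : cplx R -> cplx R) : 0 < r -> r <= 1 -> uncond_sum (disk r) f F ->
  uncond_sum (disk r) (fun n z => (1 - z)^-1 * f n z)
    (fun z => (1 - z)^-1 * F z).
Proof.
move=> r0 r1 [holF cvF]; split=> [z zr|sigma /cvF /cvg_compactly sumF].
  have z1 : (1 - z : cplx R) != 0.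
    rewrite subr_eq0; apply/eqP => z1; move/disk_cabs: zr.
    by rewrite -z1 cabs1 ltNge r1.
  apply: derivableM; last exact: holF.
  by apply: derivableV.
apply/cvg_compactly => K cK Kr e e0.
have [rho [rho0 rhor Krho]] := compact_sub_disk r0 cK Kr.
have d0 : 0 < 1 - rho by rewrite subr_gt0 (lt_le_trans rhor).
have [|n0 hn] := sumF K cK Kr (e * (1 - rho)); first exact: mulr_gt0.
exists n0 => n n0n z Kz; rewrite -mulr_sumr -mulrBr cabsM cabsV mulrC.
have dz : 1 - rho <= cabs (1 - z).
  have := cabsD (1 - z) z; rewrite subrK cabs1; have := Krho z Kz; lra.
rewrite ler_pdivrMr ?(lt_le_trans d0)//; apply: (le_trans (hn n n0n z Kz)).
by rewrite ler_pM2l.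
Qed.

Unset Implicit Arguments.

Theorem theorem2p2 (R : realType) (S : ncseries R X) (r : R)
    (F : cplx R -> cplx R)
    (S_adm : forall w : seq X, ~~ admissible w -> S w = 0)
    (r_gt0 : 0 < r) (r_le1 : r <= 1)
    (S_sum : uncond_sum (disk r) (fun n => Li (homog S n)) F) :
  [/\ uncond_sum (disk r) (fun n z => (1 - z)^-1 * Li (homog S n) z)
        (fun z => (1 - z)^-1 * F z),
      exists a : nat -> cplx R,
        power_expansion (disk r) a (fun z => (1 - z)^-1 * F z) &
      forall a : nat -> cplx R,
        power_expansion (disk r) a (fun z => (1 - z)^-1 * F z) ->
        forall N : nat, series (fun n => H (piY (homog S n)) N) @ \oo --> a N].
Proof.
have sumG := uncond_sum_div1B r_gt0 r_le1 S_sum.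
have expansion n : power_expansion (disk r)
    (fun N => \sum_(0 <= k < n) H (piY (homog S k)) N)
    (fun z => \sum_(0 <= k < n) (1 - z)^-1 * Li (homog S k) z).
  apply: power_expansion_sum => k z /disk_cabs zr.
  by apply: Li_expansion; exact: lt_le_trans zr r_le1.
have [b bG Hb] : exists2 b,
      power_expansion (disk r) b (fun z => (1 - z)^-1 * F z) &
      forall N,
        (fun n => \sum_(0 <= k < n) H (piY (homog S k)) N) @ \oo --> b N.
  apply: (power_expansion_limit r_gt0 expansion) => rho rho0 rhor e e0.
  have /cvg_compactly unif := sumG.2 id (Bijective (fun=> erefl) (fun=> erefl)).
  apply: unif e0; first exact: compact_closed_ball.
  by move=> z zrho; apply/disk_cabs; exact: le_lt_trans zrho rhor.
split; [exact: sumG | by exists b |].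
move=> a aG N; rewrite (power_expansion_unique r_gt0 aG bG); exact: Hb.
Qed.
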